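(* Let $a>0$, let $\bar\omega_h$ be a (generally non-uniform) mesh on $[0,X]$, let $\tau>0$, and let $\|\cdot\|_h$ and $\|\cdot\|_{1h}$ be any fixed norms on $H_h$. Suppose that the mesh eigenvalue problem $-\Lambda e=\lambda s_Ne$ on $\omega_h$, $e\in H_h$, $e\not\equiv 0$, has an eigenvalue $\lambda=\lambda_R+\mathrm{i}\lambda_I\in\mathbb{C}$ with $\lambda_I\neq 0$. Then the stability bound uniform in $m\geq 0$ $$\|v^m\|_h\leq C\big(\|v^0\|_h+\|u_{1N}\|_{1h}\big)\quad\text{for any } v^0,u_{1N}\in H_h,\ m\geq 0,$$ for the solutions $v$ of the compact scheme (described in the context) with data $v^0,u_{1N}$, cannot hold with any constant $C>0$.
   Context: Mesh and operators. Let $X>0$, $N\geq 2$, and let $\bar\omega_h$ be a mesh on $[0,X]$ with nodes $0=x_0<\dots<x_N=X$ and steps $h_j=x_j-x_{j-1}$, $1\le j\le N$; $\omega_h=\{x_j\}_{j=1}^{N-1}$. Let $H_h$ be the complex vector space of functions $w:\bar\omega_h\to\mathbb{C}$, $w_j=w(x_j)$, with $w_0=w_N=0$. For $1\leq j\leq N-1$ put $\hat h_j=\frac{h_j+h_{j+1}}{2}$ and $$(\Lambda w)_j=\frac{1}{\hat h_j}\Big(\frac{w_{j+1}-w_j}{h_{j+1}}-\frac{w_j-w_{j-1}}{h_j}\Big),\qquad (s_Nw)_j=\frac1{12}\big(\alpha_{hj}w_{j-1}+10\gamma_{hj}w_j+\beta_{hj}w_{j+1}\big),$$ $$\alpha_{hj}=2-\frac{h_{j+1}^2}{h_j\hat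 h_j},\qquad \gamma_{hj}=1+\frac{(h_{j+1}-h_j)^2}{5h_jh_{j+1}},\qquad \beta_{hj}=2-\frac{h_j^2}{h_{j+1}\hat h_j}.$$ Scheme. Let $a>0$, $\tau>0$, $\sigma=\frac1{12}$. For given data $v^0\in H_h$ and $u_{1N}\in H_h$ (treated as arbitrary data), a solution is a sequence $v^m\in H_h$, $m\geq 0$, starting with the given $v^0$, such that $$(s_N-\sigma\tau^2a^2\Lambda)\frac{v^{m+1}-2v^m+v^{m-1}}{\tau^2}-a^2\Lambda v^m=0\ \text{ on }\omega_h,\ m\geq 1,$$ $$(s_N-\sigma\tau^2a^2\Lambda)\frac{v^1-v^0}{\tau}-\frac{\tau}{2}a^2\Lambda v^0=u_{1N}\ \text{ on }\omega_h.$$ *)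

(* Defs.v *)
From HB Require Import structures.
From mathcomp Require Import all_boot all_order all_algebra.
From mathcomp Require Import complex reals.

Set Implicit Arguments.
Unset Strict Implicit.
Unset Printing Implicit Defensive.

Import Order.TTheory GRing.Theory Num.Theory.

Local Open Scope ring_scope.
Local Open Scope complex_scope.

Section MeshFunctions.
Variables (R : realType) (N : nat).

Definition vanishes_at_ends : {pred 'rV[R[i]]_N.+1} :=
  fun w => (w 0 ord0 == 0) && (w 0 ord_max == 0).

Lemma vanishes_at_ends_submod : submod_closed vanishes_at_ends.
Proof.
split=> [|a u v]; first by rewrite unfold_in !mxE eqxx.
rewrite !unfold_in !mxE => /andP[/eqP-> /eqP->] /andP[/eqP-> /eqP->].
by rewrite !mulr0 addr0 eqxx.
Qed.

HB.instance Definition _ := GRing.isSubmodClosed.Build R[i] 'rV[R[i]]_N.+1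
  vanishes_at_ends vanishes_at_ends_submod.

(* The space H_h: a function on the mesh is the row of its N + 1 nodal values. *)
Record meshfun := MeshFun {
  meshfun_row :> 'rV[R[i]]_N.+1;
  meshfun_ends : meshfun_row \in vanishes_at_ends }.

HB.instance Definition _ := [isSub for meshfun_row].
HB.instance Definition _ := [Choice of meshfun by <:].
HB.instance Definition _ := [SubChoice_isSubZmodule of meshfun by <:].
HB.instance Definition _ := [SubZmodule_isSubLmodule of meshfun by <:].

(* [inord] is the identity on the indices 0, ..., N, the only ones used. *)
Definition nodal (w : meshfun) (j : nat) : R[i] := meshfun_row w 0 (inord j).

End MeshFunctions.

Section Norms.
Variables (R : realType) (V : lmodType R[i]).

Record is_norm (nrm : V -> R) : Prop := IsNorm {
  norm_nonneg : forall v, 0 <= nrm v;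
  norm_definite : forall v, nrm v = 0 -> v = 0;
  norm_homogeneous : forall (c : R[i]) v,
    (nrm (c *: v))%:C = `|c| * (nrm v)%:C;
  norm_triangle : forall u v, nrm (u + v) <= nrm u + nrm v }.

End Norms.

Section Operators.
Variables (R : realType) (N : nat).

Definition is_mesh (X : R) (x : 'I_N.+1 -> R) : Prop :=
  [/\ x ord0 = 0, x ord_max = X & forall i j : 'I_N.+1, (i < j)%N -> x i < x j].

Variable x : 'I_N.+1 -> R.

Definition step (j : nat) : R := x (inord j) - x (inord j.-1).
Definition hstep (j : nat) : R := (step j + step j.+1) / 2.

Definition alpha (j : nat) : R := 2 - step j.+1 ^+ 2 / (step j * hstep j).
Definition gamma (j : nat) : R :=
  1 + (step j.+1 - step j) ^+ 2 / (5 * step j * step j.+1).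
Definition beta (j : nat) : R := 2 - step j ^+ 2 / (step j.+1 * hstep j).

(* The values of the operators below are meaningful for 0 < j < N only. *)
Definition Lambda (w : meshfun R N) (j : nat) : R[i] :=
  ((hstep j)^-1)%:C *
  ((nodal w j.+1 - nodal w j) / (step j.+1)%:C
   - (nodal w j - nodal w j.-1) / (step j)%:C).

Definition sN (w : meshfun R N) (j : nat) : R[i] :=
  12^-1 * ((alpha j)%:C * nodal w j.-1 + 10 * (gamma j)%:C * nodal w j
           + (beta j)%:C * nodal w j.+1).

Definition is_eigenvalue (lambda : R[i]) : Prop :=
  exists2 e : meshfun R N, e != 0 &
    forall j, (0 < j < N)%N -> - Lambda e j = lambda * sN e j.

Definition sigma : R := 12^-1.

Definition scheme_op (a tau : R) (w : meshfun R N) (j : nat) : R[i] :=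
  sN w j - (sigma * tau ^+ 2 * a ^+ 2)%:C * Lambda w j.

Record is_solution (a tau : R) (v0 u1 : meshfun R N)
    (v : nat -> meshfun R N) : Prop := IsSolution {
  solution_init : v 0%N = v0;
  solution_step : forall m j, (0 < m)%N -> (0 < j < N)%N ->
    scheme_op a tau
      (((tau ^+ 2)^-1)%:C *: (v m.+1 - v m *+ 2 + v m.-1)) j
    - (a ^+ 2)%:C * Lambda (v m) j = 0;
  solution_first : forall j, (0 < j < N)%N ->
    scheme_op a tau ((tau^-1)%:C *: (v 1%N - v0)) j
    - (tau / 2 * a ^+ 2)%:C * Lambda v0 j = nodal u1 j }.

End Operators.

(* Main.v *)
(* For a root q of q + 1/q = 2 - k l / (1 + sigma k l), with k = (tau a)^2, l the
   eigenvalue and e its eigenfunction, the sequence q^m e solves the scheme for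
   suitable u_1N.  The two roots have product 1, and they cannot be unimodular
   since then q + 1/q would be real, hence so would l.  So some |q| > 1, and
   q^m e grows geometrically while the data stay fixed. *)

Require Import Defs.
From HB Require Import structures.
From mathcomp Require Import all_boot all_order all_algebra.
From mathcomp Require Import complex reals.
From mathcomp Require Import ring.

Set Implicit Arguments.
Unset Strict Implicit.
Unset Printing Implicit Defensive.

Import Order.TTheory GRing.Theory Num.Theory.
Local Open Scope ring_scope.
Local Open Scope complex_scope.

Lemma exists_root_norm_gt1 (K : numClosedFieldType) (b : K) :
  b \isn't Num.real -> exists2 q : K, 1 < `|q| & q ^+ 2 - b * q + 1 = 0.
Proof.
move=> bNreal; set d := sqrtC (b ^+ 2 - 4).
have d2 : d ^+ 2 = b ^+ 2 - 4 by rewrite sqrtCK.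
pose p := (b + d) / 2; pose q := (b - d) / 2.
have pDq : p + q = b by rewrite /p /q; field.
have pq1 : p * q = 1.
  have -> : p * q = (b ^+ 2 - d ^+ 2) / 4 by rewrite /p /q; field.
  by rewrite d2; field.
have p_root : p ^+ 2 - b * p + 1 = 0 by rewrite -pDq -pq1; ring.
have q_root : q ^+ 2 - b * q + 1 = 0 by rewrite -pDq -pq1; ring.
have npq : `|p| * `|q| = 1 by rewrite -normrM pq1 normr1.
have [p_gt1|p_lt1|p_eq1] := real_ltgtP (real1 K) (normr_real p).
- by exists p.
- exists q => //; rewrite real_ltNge ?real1 ?normr_real//; apply/negP => q_le1.
  have : `|p| * `|q| <= `|p| by rewrite ler_piMr.
  by rewrite npq => /(lt_le_trans p_lt1); rewrite ltxx.
(* On the unit circle the inverse of [p] is its conjugate, so [q] is the conjugate of [p] and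
   [b = p + q] is fixed by conjugation. *)
- case/negP: bNreal; have ppc : p * p^*%R = 1 by rewrite -normCK -p_eq1 expr1n.
  have p_neq0 : p != 0 by rewrite -normr_eq0 -p_eq1 oner_eq0.
  have qE : q = p^*%R by apply: (mulfI p_neq0); rewrite pq1 ppc.
  by apply/CrealP; rewrite -pDq qE rmorphD /= conjCK addrC.
Qed.

(** Bernoulli's inequality bounds [r ^+ m] below by a function linear in [m], which passes any [M]
    by the Archimedean property. *)
Lemma exists_expr_gt (R : archiRealFieldType) (r M : R) :
  1 < r -> exists m : nat, M < r ^+ m.
Proof.
move=> r_gt1; pose d := r - 1; have d_gt0 : 0 < d by rewrite subr_gt0.
have bernoulli m : 1 + m%:R * d <= r ^+ m.
  elim: m => [|m IHm]; first by rewrite mul0r addr0 expr0.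
  have md_ge0 : 0 <= m%:R * d by rewrite mulr_ge0 // ltW.
  have := ler_wpM2l (ltW (lt_trans ltr01 r_gt1)) IHm.
  rewrite -exprS; apply: le_trans; rewrite -natr1.
  rewrite (_ : r * _ = 1 + (m%:R + 1) * d + m%:R * d * d); last by rewrite /d; ring.
  by rewrite lerDl mulr_ge0 // ltW.
exists (Num.bound `|M / d|); apply: lt_le_trans (bernoulli _).
have : M / d < (Num.bound `|M / d|)%:R.
  exact: le_lt_trans (ler_norm _) (archi_boundP (normr_ge0 _)).
by rewrite ltr_pdivrMr // => /lt_trans; apply; rewrite ltrDr ltr01.
Qed.

(** In the partial order on [R[i]], being real means being comparable with 0, and comparable numbers
    have equal imaginary parts. *)
Lemma Im_eq0_of_real (R : rcfType) (z : R[i]) :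
  z \is Num.real -> complex.Im z = 0.
Proof.
by case: z => u v; rewrite realE !lecE /= => /orP[] /andP[/eqP].
Qed.

(** The Möbius map [z |-> k z / (1 + s k z)] has real coefficients and determinant [k], so its pole
    and its inverse [r |-> r / (k (1 - r s))] are real: a real value, or a pole, would force [z] to
    be real. *)
Lemma mobius_nonreal (K : numFieldType) (k s z : K) :
  k \is Num.real -> k != 0 -> s \is Num.real -> z \isn't Num.real ->
  1 + s * k * z != 0 /\ k * z / (1 + s * k * z) \isn't Num.real.
Proof.
move=> k_real k_neq0 s_real zNreal.
have D_neq0 : 1 + s * k * z != 0.
  apply: contra zNreal => /eqP D0.
  have skN0 : s * k != 0.
    by apply/eqP => sk0; move/eqP: D0; rewrite sk0 mul0r addr0 oner_eq0.
  rewrite (_ : z = - (s * k)^-1) ?rpredN ?rpredV ?rpredM//.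
  by apply: (mulfI skN0); rewrite mulrN divff//; apply/eqP; rewrite -addr_eq0 addrC D0.
split=> //; apply: contra zNreal.
set r := k * z / _ => r_real.
have rE : r * (1 + s * k * z) = k * z by rewrite /r divfK.
clearbody r.
have zE : k * (1 - r * s) * z = r.
  by transitivity (k * z - r * (1 + s * k * z) + r); [ring | rewrite rE; ring].
(* If [r * s = 1], then [zE] gives [r = 0], a contradiction. *)
have rs_neq0 : 1 - r * s != 0.
  apply/eqP => rs0; move: (zE); rewrite rs0 mulr0 mul0r => r0.
  by move/eqP: rs0; rewrite -r0 mul0r subr0 oner_eq0.
rewrite (_ : z = r / (k * (1 - r * s))).
  by rewrite !(realM, realV, realB, real1).
by rewrite -{1}zE mulrAC divff ?mul1r// mulf_neq0.
Qed.

Section MeshOperators.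
Variables (R : realType) (N : nat) (x : 'I_N.+1 -> R).
Implicit Types (c : R[i]) (w : meshfun R N).

Lemma nodalZ c w j : nodal (c *: w) j = c * nodal w j.
Proof. by rewrite /nodal /= mxE. Qed.

Lemma LambdaZ c w j : Lambda x (c *: w) j = c * Lambda x w j.
Proof. by rewrite /Lambda !nodalZ; ring. Qed.

Lemma sNZ c w j : sN x (c *: w) j = c * sN x w j.
Proof. by rewrite /sN !nodalZ; ring. Qed.

Lemma scheme_opZ a tau c w j :
  scheme_op x a tau (c *: w) j = c * scheme_op x a tau w j.
Proof. by rewrite /scheme_op LambdaZ sNZ; ring. Qed.

Lemma exists_meshfun (f : nat -> R[i]) :
  exists w : meshfun R N, forall j, (0 < j < N)%N -> nodal w j = f j.
Proof.
pose r : 'rV[R[i]]_N.+1 := \row_i (if (0 < i < N)%N then f i else 0).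
have r_ends : r \in @vanishes_at_ends R N.
  by rewrite unfold_in !mxE /= ltnn andbF eqxx.
exists (MeshFun r_ends) => j jN; rewrite /nodal mxE inordK ?jN//.
by case/andP: jN => _ /ltnW.
Qed.

(** The last hypothesis is the characteristic equation of the three-level recurrence on the line
    spanned by [e], where [Lambda] acts as [- lambda] times [sN]. *)
Lemma geometric_solution (a tau : R) (lambda q : R[i]) e :
  tau != 0 ->
  (forall j, (0 < j < N)%N -> - Lambda x e j = lambda * sN x e j) ->
  (1 + (sigma R * tau ^+ 2 * a ^+ 2)%:C * lambda) * (q ^+ 2 - q *+ 2 + 1)
    + (tau ^+ 2 * a ^+ 2)%:C * lambda * q = 0 ->
  exists u1, is_solution x a tau e u1 (fun m => q ^+ m *: e).
Proof.
move=> tau_neq0 eigen qE.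
(* Since [u1] is free data, it is taken to be whatever the initial equation produces from [e] and
   [q *: e]. *)
have [u1 u1E] := exists_meshfun (fun j =>
  scheme_op x a tau ((tau^-1)%:C *: (q ^+ 1 *: e - e)) j
    - (tau / 2 * a ^+ 2)%:C * Lambda x e j).
exists u1; split=> [|[//|m] j _ jN|j jN]; rewrite ?expr0 ?scale1r ?u1E//=.
have LE : Lambda x e j = - (lambda * sN x e j) by rewrite -eigen ?opprK.
rewrite scalerMnl -scalerBl -scalerDl scalerA scheme_opZ LambdaZ.
rewrite /scheme_op LE.
have aE : (a ^+ 2)%:C = ((tau ^+ 2)^-1)%:C * (tau ^+ 2 * a ^+ 2)%:C :> R[i].
  by rewrite -rmorphM mulKf ?expf_neq0.
(* The time level treated is [m.+1], so the lowest power of [q] to factor out is [q ^+ m]. *)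
transitivity (((tau ^+ 2)^-1)%:C * q ^+ m * sN x e j *
  ((1 + (sigma R * tau ^+ 2 * a ^+ 2)%:C * lambda) * (q ^+ 2 - q *+ 2 + 1)
    + (tau ^+ 2 * a ^+ 2)%:C * lambda * q)); last by rewrite qE mulr0.
rewrite aE !exprS; ring.
Qed.

End MeshOperators.

Theorem proposition1 (R : realType) (N : nat) (hN : (2 <= N)%N)
  (X : R) (hX : 0 < X) (x : 'I_N.+1 -> R) (hx : is_mesh X x)
  (a : R) (ha : 0 < a) (tau : R) (htau : 0 < tau)
  (norm_h norm_1h : meshfun R N -> R)
  (hnorm_h : is_norm norm_h) (hnorm_1h : is_norm norm_1h)
  (lambda : R[i]) (hlambda : is_eigenvalue x lambda)
  (hIm : complex.Im lambda != 0) :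
  ~ (exists2 C : R, 0 < C &
       forall (v0 u1 : meshfun R N) (v : nat -> meshfun R N),
         is_solution x a tau v0 u1 v ->
         forall m : nat, norm_h (v m) <= C * (norm_h v0 + norm_1h u1)).
Proof.
case=> C _ stable; have [e e_neq0 eigen] := hlambda.
pose k : R[i] := (tau ^+ 2 * a ^+ 2)%:C.
have realC (t : R) : t%:C \is @Num.real R[i].
  by rewrite realE !lecE /= eqxx -realE num_real.
have lNreal : lambda \isn't Num.real.
  by apply: contra hIm => /Im_eq0_of_real ->.
have k_neq0 : k != 0.
  by rewrite fmorph_eq0 mulf_neq0 ?expf_neq0 ?lt0r_neq0.
have [D_neq0 muNreal] := mobius_nonreal (realC _) k_neq0 (realC (sigma R)) lNreal.
(* Dividing the characteristic equation by [D] turns it into [q ^+ 2 - (2 - mu) * q + 1 = 0]. *)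
set D := 1 + _ in D_neq0 muNreal; set mu := _ / D in muNreal.
have bNreal : 2 - mu \isn't Num.real.
  apply: contra muNreal => b_real.
  by rewrite -(subKr 2 mu) realB ?realn.
have [q q_gt1 q_root] := exists_root_norm_gt1 bNreal.
have muD : mu * D = k * lambda by rewrite /mu divfK.
have qE : (1 + (sigma R * tau ^+ 2 * a ^+ 2)%:C * lambda) * (q ^+ 2 - q *+ 2 + 1)
    + k * lambda * q = 0.
  have -> : 1 + (sigma R * tau ^+ 2 * a ^+ 2)%:C * lambda = D.
    by rewrite -(mulrA (sigma R)) rmorphM.
  rewrite -muD; transitivity (D * (q ^+ 2 - (2 - mu) * q + 1)); first by ring.
  by rewrite q_root mulr0.
have [u1 sol] := geometric_solution (lt0r_neq0 htau) eigen qE.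
have ne_gt0 : 0 < norm_h e.
  rewrite lt_neqAle norm_nonneg// andbT eq_sym.
  by apply: contra e_neq0 => /eqP /(norm_definite hnorm_h) ->.
(* The modulus [|q|] lives in [R[i]]; [r] is the same number in [R], where the norms take their
   values. *)
pose r := ComplexField.Normc.normc q.
have rE : r%:C = `|q| by [].
have r_gt1 : 1 < r by rewrite -ltcR rE.
(* The norm of [q ^+ m *: e] is [r ^+ m * norm_h e], while [u1] does not depend on [m]; this [m]
   breaks the bound. *)
have [m] := exists_expr_gt (C * (norm_h e + norm_1h u1) / norm_h e) r_gt1.
rewrite ltr_pdivrMr//; apply/negP; rewrite -leNgt.
rewrite (_ : _ * norm_h e = norm_h (q ^+ m *: e)); first exact: stable sol m.
apply: complexI; rewrite (norm_homogeneous hnorm_h) normrX -rE.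
by rewrite rmorphM rmorphXn.
Qed.
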